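(* Let $R\in\mathbb{N}$ be such that for every integer $r\ge R$ the set $\{1,2,\ldots,r\}$ can be partitioned into $3$ sum-dominant subsets, while $\{1,2,\ldots,R-1\}$ cannot be partitioned into $3$ sum-dominant subsets. Then $24\le R\le 145$.
   Context: For a finite set $A\subseteq\mathbb{N}$, define the sum set $A+A=\{a_i+a_j : a_i,a_j\in A\}$ and the difference set $A-A=\{a_i-a_j : a_i,a_j\in A\}$. The set $A$ is called sum-dominant if $|A+A|>|A-A|$. *)

(* Defs.v *)
From mathcomp Require Import all_boot all_order all_algebra.
From mathcomp Require Import finmap.

Set Implicit Arguments.
Unset Strict Implicit.
Unset Printing Implicit Defensive.

Local Open Scope fset_scope.

Definition sumset (A : {fset nat}) : {fset nat} :=
  [fset (a + b)%N | a in A, b in A].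

(* Differences are taken in int: subtraction on nat is truncated. *)
Definition diffset (A : {fset nat}) : {fset int} :=
  [fset (a%:Z - b%:Z)%R | a in A, b in A].

Definition sum_dominant (A : {fset nat}) : bool :=
  (#|` diffset A| < #|` sumset A|)%N.

(* Analogue for {fset K} of finset.partition. *)
Definition fpartition (K : choiceType) (P : {fset {fset K}}) (D : {fset K}) :=
  [&& fcover P == D, trivIfset P & fset0 \notin P].

Definition interval1 (r : nat) : {fset nat} := [fset i in iota 1 r].

Definition sum_dominant_partitionable (k r : nat) : Prop :=
  exists P : {fset {fset nat}},
    [/\ fpartition P (interval1 r), #|` P| = k
      & forall A : {fset nat}, A \in P -> sum_dominant A].

(* Main.v *)
Require Import Defs.
From mathcomp Require Import all_boot.
From mathcomp Require Import all_algebra.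
From mathcomp Require Import finmap zify.

(** Lower bound: if [R <= 23] then {1,...,23} splits into three sum-dominant
    sets, one of which has at most 7 elements; an exhaustive search over the
    subsets of {1,...,23} with at most 7 elements finds no sum-dominant one.

    Upper bound: for [r >= 53] take two fixed 10-element sum-dominant sets L
    and H inside {1,...,17}, and split {1,...,r} into L, the mirror image
    r + 1 - H, and the rest C. Away from its two ends C is a full interval, so
    which sums and differences it misses depends only on L and H: it misses 9
    sums in [2, 2r] and 10 differences in [1 - r, r - 1]. *)

Set Implicit Arguments.
Unset Strict Implicit.
Unset Printing Implicit Defensive.

Local Open Scope fset_scope.
Local Open Scope nat_scope.

(** * Membership and counting in sumsets and difference sets *)

Lemma sumsetP (A : {fset nat}) (s : nat) :
  reflect (exists a b, [/\ a \in A, b \in A & s = a + b]) (s \in sumset A).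
Proof.
apply: (iffP (imfset2P _ _ _ _ _)) => [[a aA [b bA ->]]|[a [b [aA bA ->]]]].
  by exists a, b.
by exists a => //; exists b.
Qed.

Lemma diffsetP (A : {fset nat}) (d : int) :
  reflect (exists a b, [/\ a \in A, b \in A & d = (a%:Z - b%:Z)%R])
          (d \in diffset A).
Proof.
apply: (iffP (imfset2P _ _ _ _ _)) => [[a aA [b bA ->]]|[a [b [aA bA ->]]]].
  by exists a, b.
by exists a => //; exists b.
Qed.

Lemma leq_size_fset (K : choiceType) (s : seq K) (B : {fset K}) :
  uniq s -> {subset s <= B} -> size s <= #|` B|.
Proof. exact: uniq_leq_size. Qed.

Lemma leq_fset_size (K : choiceType) (s : seq K) (B : {fset K}) :
  {subset B <= s} -> #|` B| <= size s.
Proof. by apply: uniq_leq_size; apply: fset_uniq. Qed.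

Lemma mem_interval1 (r x : nat) : (x \in interval1 r) = (1 <= x <= r).
Proof. by rewrite !inE mem_iota add1n. Qed.

Lemma sum_dominant_neq0 (A : {fset nat}) : sum_dominant A -> A != fset0.
Proof.
apply: contraTneq => ->; rewrite /sum_dominant -leqNgt.
suff -> : sumset fset0 = fset0 by rewrite cardfs0.
by apply/fsetP => s; rewrite in_fset0; apply/negbTE/sumsetP => -[a [b []]].
Qed.

(** * Sum-dominant subsets of {1,...,23} have at least 8 elements *)

Fixpoint orseq (s t : bitseq) : bitseq :=
  match s, t with
  | [::], _ => t
  | _, [::] => s
  | b :: s', c :: t' => (b || c) :: orseq s' t'
  end.

(* A bit sequence [m] encodes the set of positions of its [true] bits;
   [diffs] encodes the nonnegative differences only. *)
Fixpoint sums (m : bitseq) : bitseq :=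
  if m is b :: m' then
    let S := [:: false, false & sums m'] in if b then orseq m S else S
  else [::].

Fixpoint diffs (m : bitseq) : bitseq :=
  if m is b :: m' then
    let D := diffs m' in if b then orseq m D else D
  else [::].

Lemma nth_orseq (s t : bitseq) (i : nat) :
  nth false (orseq s t) i = nth false s i || nth false t i.
Proof.
elim: s t i => [|b s IHs] [|c t] [|i] //=; rewrite ?nth_nil ?orbF //.
Qed.

(** Completeness of [sums] bounds sumsets from above; for [diffs] the opposite inclusion follows,
    bounding difference sets from below. *)
Lemma sums_add (m : bitseq) (i j : nat) :
  nth false m i -> nth false m j -> nth false (sums m) (i + j).
Proof.
elim: m i j => [|b m IHm] [|i] [|j] //=; rewrite ?nth_nil //.
- by move=> -> _.
- by move=> -> mj; rewrite add0n /= nth_orseq mj.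
- by move=> mi ->; rewrite addn0 /= nth_orseq mi.
- move=> mi mj; rewrite addSn addnS.
  by case: b; rewrite /= ?nth_orseq /= IHm ?orbT.
Qed.

Lemma diffs_sub (m : bitseq) (k : nat) :
  nth false (diffs m) k -> exists2 i, nth false m i & nth false m (i + k).
Proof.
elim: m => [|[] m IHm]; first by rewrite nth_nil.
  rewrite -/(orseq (true :: m) (diffs m)) nth_orseq => /orP[mk|/IHm[i mi mik]]; first by exists 0.
  by exists i.+1.
by move=> /IHm[i mi mik]; exists i.+1.
Qed.

Definition ones (s : bitseq) : seq nat :=
  [seq i <- iota 0 (size s) | nth false s i].

Lemma mem_ones (s : bitseq) (i : nat) : (i \in ones s) = nth false s i.
Proof.
rewrite mem_filter mem_iota /= add0n.
by case: ltnP => [|/(nth_default false) ->]; rewrite ?andbT.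
Qed.

Lemma ones_uniq (s : bitseq) : uniq (ones s).
Proof. by rewrite filter_uniq ?iota_uniq. Qed.

Lemma size_ones (s : bitseq) : size (ones s) = count id s.
Proof. by rewrite size_filter -[in RHS](mkseq_nth false s) count_map. Qed.

(* The negative differences are the opposites of the positive ones,
   hence [behead]. *)
Definition not_dominant (S D : bitseq) : bool :=
  count id S <= count id D + count id (behead D).

(** [n] bits remain to be prepended to [m], at most [k] of them true; [S] and [D] carry [sums m] and
    [diffs m], updated bit by bit. *)
Fixpoint search (n k : nat) (m S D : bitseq) : bool :=
  if n is n'.+1 then
    search n' k (false :: m) [:: false, false & S] D &&
    (if k is k'.+1 then
       let m' := true :: m in
       search n' k' m' (orseq m' [:: false, false & S]) (orseq m' D)
     else true)
  else not_dominant S D.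

Lemma searchP (n k : nat) (m m' : bitseq) :
  search n k m (sums m) (diffs m) -> size m' = n -> count id m' <= k ->
  not_dominant (sums (catrev m' m)) (diffs (catrev m' m)).
Proof.
elim: n k m m' => [|n IHn] k m [|b m'] //= /andP[skip take] [sz].
(* The updated [S] and [D] reduce to [sums] and [diffs] of the extended sequence. *)
case: b => /= [|km']; last exact: IHn skip sz km'.
case: k skip take => // k _ take; rewrite add1n ltnS => km'.
exact: IHn take sz km'.
Qed.

Lemma search_23_7 : search 23 7 [::] [::] [::].
Proof. by vm_compute. Qed.

Definition mask_of (n : nat) (A : {fset nat}) : bitseq :=
  [seq i.+1 \in A | i <- iota 0 n].

Lemma nth_mask_of (n : nat) (A : {fset nat}) (i : nat) :
  nth false (mask_of n A) i = (i < n) && (i.+1 \in A).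
Proof.
case: ltnP => [lt_in|le_ni]; last by rewrite nth_default ?size_map ?size_iota.
by rewrite (nth_map 0) ?size_iota // nth_iota.
Qed.

Lemma count_mask_of (n : nat) (A : {fset nat}) :
  count id (mask_of n A) <= #|` A|.
Proof.
rewrite -size_ones -(size_map succn); apply: leq_size_fset.
  by rewrite map_inj_uniq ?ones_uniq //; apply: succn_inj.
by move=> _ /mapP[i + ->]; rewrite mem_ones nth_mask_of => /andP[].
Qed.

Lemma card_sumset_mask_of (n : nat) (A : {fset nat}) :
  A `<=` interval1 n -> #|` sumset A| <= count id (sums (mask_of n A)).
Proof.
(* Position [k] of a mask stands for the element [k + 1], so position [k] of [sums] stands for the
   sum [k + 2]. *)
move=> /fsubsetP An; rewrite -size_ones -(size_map (fun k => k.+2)).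
apply: leq_fset_size => _ /sumsetP[a [b [aA bA ->]]].
have := An _ aA; have := An _ bA; rewrite !mem_interval1.
case: a b aA bA => [|a] [|b] // aA bA /andP[_ bn] /andP[_ an].
apply/mapP; exists (a + b); last by rewrite addSn addnS.
by rewrite mem_ones sums_add // nth_mask_of ?aA ?bA ?an ?bn.
Qed.

Lemma card_diffset_mask_of (n : nat) (A : {fset nat}) (D := diffs (mask_of n A)) :
  count id D + count id (behead D) <= #|` diffset A|.
Proof.
have memD k : nth false D k ->
    exists a b, [/\ a \in A, b \in A & a = b + k].
  move=> /diffs_sub[i]; rewrite !nth_mask_of => /andP[_ iA] /andP[_ ikA].
  by exists (i + k).+1, i.+1; rewrite addSn.
(* [Negz k] is [-(k + 1)], matching position [k] of [behead]. *)
rewrite -!size_ones -(size_map Posz) -[X in _ + X](size_map Negz) -size_cat.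
apply: leq_size_fset.
  rewrite cat_uniq !map_inj_uniq ?ones_uniq; try by move=> ? ? [].
  by rewrite andbT /=; apply/hasPn => _ /mapP[k _ ->]; apply/mapP => -[].
move=> d; rewrite mem_cat => /orP[] /mapP[k]; rewrite mem_ones => kD ->.
  have [a [b [aA bA eab]]] := memD _ kD.
  by apply/diffsetP; exists a, b; split=> //; lia.
rewrite nth_behead in kD; have [a [b [aA bA eab]]] := memD _ kD.
by apply/diffsetP; exists b, a; split=> //; lia.
Qed.

Lemma sum_dominant_card_gt7 (A : {fset nat}) :
  A `<=` interval1 23 -> sum_dominant A -> 7 < #|` A|.
Proof.
move=> A23 sdA; rewrite ltnNge; apply/negP => A7.
(* [search] prepends bits, so the mask is fed in reverse. *)
have := @searchP 23 7 [::] (rev (mask_of 23 A)) search_23_7.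
rewrite size_rev size_map size_iota count_rev -/(rev _) revK.
move=> /(_ erefl (leq_trans (count_mask_of _ _) A7)) small.
have := leq_trans sdA (card_sumset_mask_of A23).
by rewrite ltnNge (leq_trans small (card_diffset_mask_of _ _)).
Qed.

Lemma not_partitionable_23 : ~ sum_dominant_partitionable 3 23.
Proof.
case=> P [/and3P[/eqP covP trivP _] cardP sdP].
have : \sum_(A <- P) 8 <= \sum_(A <- P) #|` A|.
  rewrite big_seq [X in _ <= X]big_seq; apply: leq_sum => A AP.
  apply: sum_dominant_card_gt7 (sdP _ AP).
  by rewrite -covP /fcover (big_fsetD1 A) //= fsubsetUl.
(* By disjointness the block sizes add up to 23, below [3 * 8]. *)
rewrite (eqP trivP) covP card_fseq undup_id ?iota_uniq // size_iota.
by rewrite big_const_seq count_predT cardP.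
Qed.

(** * Partitions of {1,...,r} *)

(** For a concrete list the premise is decided by evaluation. *)
Lemma sum_dominant_fseq (s : seq nat) :
  size (undup [seq (a%:Z - b%:Z)%R | a <- s, b <- s]) <
    size (undup [seq a + b | a <- s, b <- s]) ->
  sum_dominant [fset x in s].
Proof.
move=> sd; apply: leq_ltn_trans (leq_trans sd _).
  apply: leq_fset_size => _ /diffsetP[a [b [+ + ->]]].
  by rewrite !inE mem_undup => a_s b_s; apply: allpairs_f.
apply: leq_size_fset (undup_uniq _) _ => x.
rewrite mem_undup => /allpairsP[[a b] /= [a_s b_s ->]].
by apply/sumsetP; exists a, b; rewrite !inE.
Qed.

(** Reflection negates differences and sends a sum [s] to [2 * c - s]; the bound [a <= c] keeps
    truncated subtraction exact. *)
Lemma sum_dominant_reflect (c : nat) (A : {fset nat}) :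
  {in A, forall a, a <= c} -> sum_dominant A ->
  sum_dominant [fset c - a | a in A].
Proof.
move=> Ac sdA; set B := [fset c - a | a in A].
have memB a : a \in A -> c - a \in B by move=> aA; apply: in_imfset.
apply: leq_ltn_trans (leq_trans sdA _).
  apply/fsubset_leq_card/fsubsetP => d.
  move=> /diffsetP[_ [_ [/imfsetP[a /= aA ->] /imfsetP[b /= bA ->] ->]]].
  apply/diffsetP; exists b, a; split=> //.
  by have := Ac _ aA; have := Ac _ bA; lia.
rewrite -(size_map (fun s => 2 * c - s)); apply: leq_size_fset.
  rewrite map_inj_in_uniq ?fset_uniq // => _ s /sumsetP[a [b [aA bA ->]]].
  move=> /sumsetP[a' [b' [aA' bA' ->]]].
  by move: (Ac _ aA) (Ac _ bA) (Ac _ aA') (Ac _ bA'); lia.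
move=> _ /mapP[_ /sumsetP[a [b [aA bA ->]]] ->].
apply/sumsetP; exists (c - a), (c - b); rewrite !memB //; split=> //.
by have := Ac _ aA; have := Ac _ bA; lia.
Qed.

Lemma fpartition3 (K : choiceType) (A B C D : {fset K}) :
  A != fset0 -> B != fset0 -> C != fset0 ->
  [disjoint A & B]%fset -> [disjoint A & C]%fset -> [disjoint B & C]%fset ->
  A `|` B `|` C = D ->
  fpartition [fset A; B; C] D /\ #|` [fset A; B; C]| = 3.
Proof.
move=> A0 B0 C0 dAB dAC dBC eD.
have neq (X Y : {fset K}) : X != fset0 -> [disjoint X & Y]%fset -> X != Y.
  by move=> X0; apply: contraTneq => <-; rewrite -fsetI_eq0 fsetIid.
have nAB := neq _ _ A0 dAB; have nAC := neq _ _ A0 dAC.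
have nBC := neq _ _ B0 dBC.
have nC : C \notin [fset A; B] by rewrite !inE !(eq_sym C) negb_or nAC.
split; last by rewrite fsetUC cardfsU1 nC cardfs2 nAB.
apply/and3P; split.
- rewrite /fcover fsetUC big_fsetU1 //= big_fsetU1 ?inE //= big_seq_fset1.
  by rewrite fsetUC eD.
- apply/trivIfsetP => X Y.
  rewrite !inE => /orP[/orP[]|] /eqP-> /orP[/orP[]|] /eqP-> //;
    by rewrite ?eqxx // fdisjoint_sym.
- by rewrite !inE !negb_or !(eq_sym fset0) A0 B0 C0.
Qed.

(** * The core, its sums and its differences *)

Definition low_holes : seq nat := [:: 1; 2; 4; 8; 9; 10; 13; 15; 16; 17].
(** Counted down from [r + 1]: a hole [x] here removes [r + 1 - x]. *)
Definition high_holes : seq nat := [:: 1; 3; 4; 8; 9; 10; 12; 15; 16; 17].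

Definition core (r : nat) : {fset nat} :=
  [fset i in interval1 r | (i \notin low_holes) && (r.+1 - i \notin high_holes)].

Lemma mem_core (r i : nat) :
  (i \in core r) =
    [&& 1 <= i <= r, i \notin low_holes & r.+1 - i \notin high_holes].
Proof. by rewrite /core in_fset inE /= mem_interval1. Qed.

Lemma holes_gt17 (i : nat) :
  17 < i -> (i \notin low_holes) && (i \notin high_holes).
Proof. by rewrite !inE; lia. Qed.

(** Here [r + 1 - i] is at least 18, beyond every high hole. *)
Lemma low_mem_core (r i : nat) :
  35 <= r -> 0 < i <= r - 17 -> i \notin low_holes -> i \in core r.
Proof.
move=> r35 /andP[i0 ir] il; rewrite mem_core il i0 /=.
have /andP[_ ->] : (r.+1 - i \notin low_holes) && (r.+1 - i \notin high_holes).
  by apply: holes_gt17; lia.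
by rewrite andbT; lia.
Qed.

Lemma high_mem_core (r i : nat) :
  35 <= r -> 0 < i <= r - 17 -> i \notin high_holes -> r.+1 - i \in core r.
Proof.
move=> r35 /andP[i0 ir] ih; rewrite mem_core subKn ?ih ?andbT; last by lia.
have /andP[-> _] : (r.+1 - i \notin low_holes) && (r.+1 - i \notin high_holes).
  by apply: holes_gt17; lia.
by rewrite andbT; lia.
Qed.

Definition avoiding_sum (s : nat) (holes : seq nat) : bool :=
  has (fun a => (a \notin holes) && (s - a \notin holes)) (iota 1 s.-1).

Lemma avoiding_sumP (s : nat) (holes : seq nat) : avoiding_sum s holes ->
  exists a b, [/\ 0 < a, 0 < b, a \notin holes, b \notin holes & a + b = s].
Proof.
case/hasP=> a; rewrite mem_iota => sa /andP[ah bh].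
by exists a, (s - a); split=> //; lia.
Qed.

(** A finite check. This end misses the sums 2, 3, 4, 5, 7; the mirrored end misses 2, 3, 5, 6. *)
Lemma low_sums (s : nat) : s \in 6 :: iota 8 28 -> avoiding_sum s low_holes.
Proof. by move: s; apply/allP. Qed.

Lemma high_sums (s : nat) : s \in 4 :: iota 7 29 -> avoiding_sum s high_holes.
Proof. by move: s; apply/allP. Qed.

Lemma mem_sumset_core (r s : nat) : 53 <= r ->
  s \in [:: 6, 2 * r - 2 & iota 8 (2 * r - 12)] -> s \in sumset (core r).
Proof.
move=> r53 s_in; have [s_low|s36] := leqP s 35.
  have /low_sums/avoiding_sumP[a [b [a0 b0 ah bh eab]]] : s \in 6 :: iota 8 28.
    by move: s_in; rewrite !inE !mem_iota; lia.
  by apply/sumsetP; exists a, b; split=> //; apply: low_mem_core => //; lia.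
(* [2 * r - 33] is the mirror image of 35 under [s -> 2 * (r + 1) - s]. *)
have [s_high|s_mid] := leqP (2 * r - 33) s.
  have /high_sums/avoiding_sumP[a [b [a0 b0 ah bh eab]]] :
      2 * r.+1 - s \in 4 :: iota 7 29.
    by move: s_in; rewrite !inE !mem_iota; lia.
  apply/sumsetP; exists (r.+1 - a), (r.+1 - b).
  by split; [apply: high_mem_core => //; lia..|lia].
(* Now [36 <= s <= 2 * r - 34], so both halves lie between 18 and [r - 17], clear of all holes. *)
apply/sumsetP; exists s./2, (s - s./2); have := odd_double_half s => es.
have mid i : 17 < i <= r - 17 -> i \in core r.
  move=> /andP[i17 ir]; apply: low_mem_core; [lia..|].
  by have /andP[] := holes_gt17 i17.
by split; [apply: mid; lia..|lia].
Qed.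

(** For core elements [b] and [r + 1 - c], the difference [(r + 1 - c) - b] is [r + 1 - (b + c)]: a
    missing value of [b + c] is a missing large difference. *)
Lemma missing_fringe_sums (b c : nat) :
  0 < b -> 0 < c -> b \notin low_holes -> c \notin high_holes ->
  b + c \notin [:: 2; 3; 4; 6; 15].
Proof.
move=> b0 c0 bl ch; have [lt15|gt15] := leqP (b + c) 15; last by rewrite !inE; lia.
(* Both summands are at most 14, which leaves a finite check. *)
have /allP/(_ b) : all (fun b => all (fun c => [|| b \in low_holes,
    c \in high_holes | b + c \notin [:: 2; 3; 4; 6; 15]]) (iota 1 14)) (iota 1 14).
  by [].
rewrite mem_iota => /(_ ltac:(lia)) /allP/(_ c).
by rewrite mem_iota (negbTE bl) (negbTE ch) => /(_ ltac:(lia)).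
Qed.

(** Additive form, free of truncation, of: [a - b] is at most [r - 1] and avoids [r - 14], [r - 5],
    [r - 3], [r - 2], [r - 1]. *)
Lemma core_gap (r a b : nat) : a \in core r -> b \in core r ->
  [&& a + 1 <= b + r, a + 14 != b + r, a + 5 != b + r, a + 3 != b + r,
    a + 2 != b + r & a + 1 != b + r].
Proof.
rewrite !mem_core => /and3P[ar _ ah] /and3P[br bl _].
have := @missing_fringe_sums b (r.+1 - a) ltac:(lia) ltac:(lia) bl ah.
by rewrite !inE; lia.
Qed.

Lemma sum_dominant_core (r : nat) : 53 <= r -> sum_dominant (core r).
Proof.
move=> r53.
have sum_card : 2 * r - 10 <= #|` sumset (core r)|.
  have -> : 2 * r - 10 = size [:: 6, 2 * r - 2 & iota 8 (2 * r - 12)].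
    by rewrite /= size_iota; lia.
  apply: leq_size_fset => [|s]; last exact: mem_sumset_core.
  by rewrite /= !inE !mem_iota iota_uniq; lia.
(* The positive differences that [core_gap] allows. *)
pose D := iota 1 (r - 15) ++ (r - 4) :: iota (r - 13) 8.
have sizeD : size D = r - 6 by rewrite size_cat /= !size_iota; lia.
have memD d : d \in D = [|| 1 <= d <= r - 15, d == r - 4 | r - 13 <= d <= r - 6].
  by rewrite mem_cat inE !mem_iota; lia.
apply: leq_trans sum_card.
(* Zero and both signs of [D] give at most [2 * r - 11] differences, one fewer than the [2 * r - 10]
   sums. *)
apply: (@leq_ltn_trans (size (0%R :: map Posz D ++ map (fun d => - d%:Z)%R D))); last first.
  by rewrite /= size_cat !size_map sizeD; lia.
apply: leq_fset_size => _ /diffsetP[a [b [aC bC ->]]].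
have gab := core_gap aC bC; have gba := core_gap bC aC.
rewrite inE mem_cat; have [ltab|ltba|->] := ltngtP a b; last by rewrite GRing.subrr.
  apply/orP; right; apply/orP; right; apply/mapP; exists (b - a); last by lia.
  by rewrite memD; lia.
apply/orP; right; apply/orP; left; apply/mapP; exists (a - b); last by lia.
by rewrite memD; lia.
Qed.

Lemma partitionable (r : nat) : 53 <= r -> sum_dominant_partitionable 3 r.
Proof.
move=> r53; pose L := [fset x in low_holes].
pose H := [fset r.+1 - x | x in [fset x in high_holes]].
have memL x : (x \in L) = (x \in low_holes) by rewrite in_fset.
have small x : (x \in low_holes) || (x \in high_holes) -> 0 < x <= 17.
  by rewrite !inE; lia.
have memH x : (x \in H) = (x <= r) && (r.+1 - x \in high_holes).
  apply/imfsetP/andP => [[y /=]|[xr xh]].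
    rewrite in_fset => yh ->; have := small y; rewrite yh orbT => /(_ isT) y17.
    by rewrite subKn; [split=> //; lia|lia].
  by exists (r.+1 - x); [rewrite /= in_fset|lia].
have sdL : sum_dominant L by apply: sum_dominant_fseq.
have sdH : sum_dominant H.
  apply: sum_dominant_reflect; last by apply: sum_dominant_fseq.
  move=> x; rewrite in_fset => /= xh.
  by have := small x; rewrite xh orbT => /(_ isT); lia.
have sdC := sum_dominant_core r53.
have [partP cardP] : fpartition [fset L; H; core r] (interval1 r) /\
    #|` [fset L; H; core r]| = 3.
  apply: fpartition3; rewrite ?sum_dominant_neq0 //.
  (* A common element would have [x <= 17] and [r + 1 - x <= 17], forcing [r <= 33]. *)
  - apply/fdisjointP => x; rewrite memL memH => xl; apply/negP => /andP[_ xh].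
    have := small x; have := small (r.+1 - x); rewrite xl xh orbT => /(_ isT).
    by move=> ? /(_ isT); lia.
  - by apply/fdisjointP => x; rewrite memL mem_core => ->; rewrite andbF.
  - by apply/fdisjointP => x; rewrite memH mem_core => /andP[_ ->]; rewrite !andbF.
  - apply/fsetP => x; rewrite !in_fsetU memL memH mem_core mem_interval1.
    have := small x; have := small (r.+1 - x).
    case: (x \in low_holes); case: (r.+1 - x \in high_holes);
      rewrite ?orbT //=; lia.
exists [fset L; H; core r]; split=> // A.
by rewrite !inE => /orP[/orP[]|] /eqP->.
Qed.

Theorem theorem3 (R : nat)
    (hR : forall r : nat, R <= r -> sum_dominant_partitionable 3 r)
    (hR1 : ~ sum_dominant_partitionable 3 (R - 1)) :
  24 <= R <= 145.
Proof.
apply/andP; split.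
  by rewrite ltnNge; apply/negP => R23; apply: not_partitionable_23; apply: hR.
(* Here [R - 1] is at least 145, well above the threshold 53. *)
rewrite leqNgt; apply/negP => R146; apply: hR1; apply: partitionable; lia.
Qed.
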